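(* Let $d,N,T\ge 1$, let $(\mathbf{x}_\xi,y_\xi)\in\mathbb{R}^d\times\mathbb{R}$, $\xi\in\{0,\dots,N-1\}$, be a dataset, let $\mathbf{R}\in\mathbb{R}^{d\times d}$ be a fixed matrix with $\mathbf{R}\mathbf{R}^\top=\mathbf{I}$, and let $Q_x,Q_w:\mathbb{R}^d\to\mathbb{R}^d$ be uniform quantizers (as defined in the context). Let $\mathbb{E}_\xi$ denote expectation over $\xi$ uniform on $\{0,\dots,N-1\}$. For $\mathbf{w}\in\mathbb{R}^d$ define $$\widehat{\mathcal{L}}(\mathbf{w}) := \tfrac12\,\mathbb{E}_\xi\big[(\langle Q_x(\mathbf{R}\mathbf{x}_\xi), Q_w(\mathbf{R}\mathbf{w})\rangle - y_\xi)^2\big],\qquad \mathbf{G}:=\mathbb{E}_\xi\big[Q_x(\mathbf{R}\mathbf{x}_\xi)Q_x(\mathbf{R}\mathbf{x}_\xi)^\top\big].$$ Let $\mathbf{w}^0\in\mathbb{R}^d$ be deterministic and, for $t\ge 0$, let $$\mathbf{w}^{t+1}=\mathbf{w}^t-\eta\,\big(\langle Q_x(\mathbf{R}\mathbf{x}_t),Q_w(\mathbf{R}\mathbf{w}^t)\rangle-y_t\big)\,\mathbf{R}^\top Q_x(\mathbf{R}\mathbf{x}_t),$$ where $(\mathbf{x}_t,y_t)$ denotes the sample drawn at iteration $t$, the samples being drawn independently across iterations and uniformly from the dataset. Assume: (1) (Gram matrix) there exist constants $\lambda_{\min},\rho>0$ such that $\mathbf{G}^2\succeq\lambda_{\min}\mathbf{G}$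 and, almost surely, $\sup_{0\le t\le T-1}\|Q_x(\mathbf{R}\mathbf{x}_t)\|_{\mathbf{G}}^2\le\rho$; (2) (Interpolation) for any orthogonal matrix $\mathbf{R}'\in\mathbb{R}^{d\times d}$ there exists $\mathbf{w}^\star_{\mathbf{R}'}\in\mathbb{R}^d$ such that $y_\xi=\langle Q_x(\mathbf{R}'\mathbf{x}_\xi),\mathbf{w}^\star_{\mathbf{R}'}\rangle$ for every $\xi$. If $\eta=\lambda_{\min}/(6\rho)$, then for any $t\ge 0$, $$\mathbb{E}\big[\widehat{\mathcal{L}}(\mathbf{w}^{t+1})\big]\le(1-\mu)^{t+1}\,\widehat{\mathcal{L}}(\mathbf{w}^0)+(6+2\mu^{-1})\sum_{s=0}^{t+1}(1-\mu)^{t-s}\,\mathbb{E}\big[\|\mathbf{e}(\mathbf{R}\mathbf{w}^s)\|_{\mathbf{G}}^2\big],$$ where $\mu=\frac{\lambda_{\min}^2}{12\rho}$, $\mathbf{e}(\mathbf{v}):=Q_w(\mathbf{v})-\mathbf{v}$, and the outer expectations are over the random samples drawn in the recursion.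
   Context: $\langle\cdot,\cdot\rangle$ is the Euclidean inner product; for a square matrix $\mathbf{K}$, $\|\mathbf{v}\|_{\mathbf{K}}^2:=\langle\mathbf{v},\mathbf{K}\mathbf{v}\rangle$; $\succeq$ is the Loewner order on symmetric matrices. Uniform quantizer with $b$ bits: for $\mathbf{X}\in\mathbb{R}^d$, $$Q(\mathbf{X})=\Big(\mathrm{clamp}_b\big(\lfloor \mathbf{X}/s(\mathbf{X})\rceil+z(\mathbf{X})\big)-z(\mathbf{X})\Big)\,s(\mathbf{X}),$$ where $\lfloor\cdot\rceil$ is element-wise rounding to a nearest integer, the scalar $z(\mathbf{X})\in\mathbb{Z}$ is added/subtracted element-wise, and $s(\mathbf{X})\in\mathbb{R}$ is a scalar scaling. With a constant clipping factor $c\in(0,1]$, the quantizer is one of: - symmetric ($b\ge2$): $s(\mathbf{X})=c\,\frac{\max_i|\mathbf{X}_i|}{2^{b-1}-1}$, $z(\mathbf{X})=0$, $\mathrm{clamp}_b(\mathbf{X})=\max\{-2^{b-1},\min\{\mathbf{X},2^{b-1}-1\}\}$ element-wise; - asymmetric ($b\ge 1$): $s(\mathbf{X})=c\,\frac{\max_i\mathbf{X}_i-\min_i\mathbf{X}_i}{2^b-1}$, $z(\mathbf{X})=\left\lfloor\frac{-\min_i\mathbf{X}_i}{s(\mathbf{X})}\right\rceil$, $\mathrm{clamp}_b(\mathbf{X})=\max\{0,\min\{\mathbf{X},2^b-1\}\}$ element-wise. When $s(\mathbf{X})=0$, set $Q(\mathbf{X})=\mathbf{X}$. The quantizers $Q_x$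 and $Q_w$ may have different types, bit-widths and clipping factors. *)

(* Defs.v *)
From HB Require Import structures.
From mathcomp Require Import all_boot all_order all_algebra.
From mathcomp Require Import all_classical all_reals all_analysis.

Set Implicit Arguments.
Unset Strict Implicit.
Unset Printing Implicit Defensive.

Import Order.TTheory GRing.Theory Num.Theory.

Local Open Scope classical_set_scope.
Local Open Scope ring_scope.

Section LinearAlgebra.
Context {R : realType} {n : nat}.
Implicit Types (u v : 'cV[R]_n) (K A B : 'M[R]_n).

Definition inner u v : R := \sum_i u i 0 * v i 0.

Definition sqnorm K v : R := inner v (K *m v).

Definition orthogonal_mx A : Prop := A *m A^T = 1%:M.

Definition loewner_ge A B : Prop :=
  [/\ A^T = A, B^T = B & forall v, 0 <= inner v ((A - B) *m v)].

End LinearAlgebra.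

(* Ties are left to [r]: any fixed deterministic tie-breaking rule qualifies. *)
Definition nearest_int {R : realType} (r : R -> int) : Prop :=
  forall (x : R) (k : int), `|x - (r x)%:~R| <= `|x - k%:~R|.

Inductive quantizer_type := Symmetric | Asymmetric.

Record quantizer (R : realType) := Quantizer {
  qtype : quantizer_type;
  qbits : nat;
  qclip : R;
  qround : R -> int;
  qbits_ok : (if qtype is Symmetric then 2 <= qbits else 1 <= qbits)%N;
  qclip_ok : 0 < qclip <= 1;
  qround_ok : nearest_int qround }.

Section Quantizer.
Context {R : realType} {d : nat}.
Variable Q : quantizer R.
Implicit Type X : 'cV[R]_d.+1.

(* The neutral value of these two folds is an entry of [X], so they are the
   maximum and the minimum over the (nonempty) set of entries. *)
Definition vmax X : R := \big[Num.max/X ord0 0]_i X i 0.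
Definition vmin X : R := \big[Num.min/X ord0 0]_i X i 0.

Definition qscale X : R :=
  match qtype Q with
  | Symmetric =>
      qclip Q * (vmax (map_mx Num.norm X) / (2 ^+ (qbits Q).-1 - 1))
  | Asymmetric => qclip Q * ((vmax X - vmin X) / (2 ^+ qbits Q - 1))
  end.

Definition qzero X : int :=
  match qtype Q with
  | Symmetric => 0
  | Asymmetric => qround Q (- vmin X / qscale X)
  end.

Definition qclamp (k : int) : int :=
  match qtype Q with
  | Symmetric =>
      Num.max (- 2 ^+ (qbits Q).-1) (Num.min k (2 ^+ (qbits Q).-1 - 1))
  | Asymmetric => Num.max 0 (Num.min k (2 ^+ qbits Q - 1))
  end.

Definition quantize X : 'cV[R]_d.+1 :=
  if qscale X == 0 then X
  else \col_i ((qclamp (qround Q (X i 0 / qscale X) + qzero X) - qzero X)%:~R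
               * qscale X).

Definition qerr X : 'cV[R]_d.+1 := quantize X - X.

End Quantizer.

Section QuantizedRegression.
Context {R : realType} {d N : nat}.
Variables (x : 'I_N -> 'cV[R]_d.+1) (y : 'I_N -> R) (A : 'M[R]_d.+1).
Variables Qx Qw : quantizer R.

Definition qloss (w : 'cV[R]_d.+1) : R :=
  2^-1 * (N%:R^-1 * \sum_(i < N)
    (inner (quantize Qx (A *m x i)) (quantize Qw (A *m w)) - y i) ^+ 2).

Definition qgram : 'M[R]_d.+1 :=
  N%:R^-1 *: \sum_(i < N)
    quantize Qx (A *m x i) *m (quantize Qx (A *m x i))^T.

(* [i t] is the index of the sample drawn at iteration [t]. *)
Fixpoint qsgd (eta : R) (w0 : 'cV[R]_d.+1) (i : nat -> 'I_N) (t : nat) :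
    'cV[R]_d.+1 :=
  if t is s.+1 then
    let w := qsgd eta w0 i s in
    w - (eta * (inner (quantize Qx (A *m x (i s))) (quantize Qw (A *m w))
                - y (i s))) *: (A^T *m quantize Qx (A *m x (i s)))
  else w0.

End QuantizedRegression.

Definition iid_uniform {dO : measure_display} {Omega : measurableType dO}
    {R : realType} (P : probability Omega R) {N : nat}
    (xi : nat -> Omega -> 'I_N) : Prop :=
  [/\ forall t (B : set 'I_N), measurable (xi t @^-1` B),
      forall t i, P (xi t @^-1` [set i]) = (N%:R^-1)%:E
    & forall (J : seq nat) (B : nat -> set 'I_N), uniq J ->
        P (\bigcap_(t in [set` J]) xi t @^-1` B t)
        = (\prod_(t <- J) P (xi t @^-1` B t))%E].

(* Main.v *)
(* Write [q_i] for the quantized samples, [u = A w - w*] and [z = Q_w(A w) - w*],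
   where [w*] interpolates the data for the rotation [A]; then the loss is
   [|z|_G^2 / 2], the quantization error is [z - u], and one step reads
   [u' = u - eta <q, z> q].  Averaging [|u'|_G^2] over [q] gives
   [|u|_G^2 - 2 eta <G z, G u> + eta^2 E(<q, z>^2 |q|_G^2)].  Polarization turns
   the cross term into [- eta (|G z|^2 + |G u|^2 - |G (z - u)|^2)], where
   [G^2 >= lambda G] bounds the first two parts.  AM-GM and [|q|_G^2 <= rho] give
   [2 |G v|^2 <= (lambda + rho / lambda) |v|_G^2], which bounds the third part and
   forces [lambda^2 <= rho] unless [G = 0].  Hence
   [E |u'|_G^2 <= (1 - 2 mu) E |u|_G^2 + E |z - u|_G^2 / 6], and the gap between
   [1 - 2 mu] and [1 - mu] pays for passing between [u] and [z] at both ends. *)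
Require Import Defs.
From HB Require Import structures.
From mathcomp Require Import all_boot all_order all_algebra.
From mathcomp Require Import all_classical all_reals all_analysis.
From mathcomp Require Import ring lra.

Set Implicit Arguments.
Unset Strict Implicit.
Unset Printing Implicit Defensive.

Import Order.TTheory GRing.Theory Num.Theory.

Local Open Scope classical_set_scope.
Local Open Scope ring_scope.

(** * Euclidean inner product and rank-one matrices *)

Section Inner.
Context {R : realType} {n : nat}.
Implicit Types u v w : 'cV[R]_n.

Lemma innerC u v : inner u v = inner v u.
Proof. by apply: eq_bigr => i _; rewrite mulrC. Qed.

Lemma innerDr u v w : inner u (v + w) = inner u v + inner u w.
Proof.
by rewrite -big_split; apply: eq_bigr => i _; rewrite !mxE mulrDr.
Qed.

Lemma innerZr a u v : inner u (a *: v) = a * inner u v.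
Proof. by rewrite /inner mulr_sumr; apply: eq_bigr => i _; rewrite !mxE mulrCA. Qed.

Lemma innerBr u v w : inner u (v - w) = inner u v - inner u w.
Proof. by rewrite innerDr -scaleN1r innerZr mulN1r. Qed.

Lemma inner_sumr (I : finType) u (F : I -> 'cV[R]_n) :
  inner u (\sum_i F i) = \sum_i inner u (F i).
Proof.
rewrite /inner exchange_big; apply: eq_bigr => i _ /=.
by rewrite summxE mulr_sumr.
Qed.

Lemma mulmx_outer u v w : (u *m v^T) *m w = inner v w *: u.
Proof.
rewrite -mulmxA [v^T *m w]mx11_scalar mul_mx_scalar; congr (_ *: _).
by rewrite mxE; apply: eq_bigr => i _; rewrite mxE.
Qed.

End Inner.

(** * The Gram seminorm and one averaged descent step *)

Section Gram.
Context {R : realType} {n N : nat}.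
Variable q : 'I_N -> 'cV[R]_n.
Implicit Types u v w z : 'cV[R]_n.

Let G : 'M[R]_n := N%:R^-1 *: \sum_i q i *m (q i)^T.

Lemma gram_mulmx v : G *m v = N%:R^-1 *: \sum_i inner (q i) v *: q i.
Proof.
rewrite -scalemxAl mulmx_suml; congr (_ *: _).
by apply: eq_bigr => i _; rewrite mulmx_outer.
Qed.

Lemma inner_gram u v :
  inner u (G *m v) = N%:R^-1 * \sum_i inner (q i) u * inner (q i) v.
Proof.
rewrite gram_mulmx innerZr inner_sumr; congr (_ * _).
by apply: eq_bigr => i _; rewrite innerZr mulrC (innerC u).
Qed.

Lemma inner_gramC u v : inner u (G *m v) = inner v (G *m u).
Proof. by rewrite !inner_gram; congr (_ * _); apply: eq_bigr => i _; rewrite mulrC. Qed.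

Lemma inner_gram_gram u v : inner u (G *m (G *m v)) = inner (G *m u) (G *m v).
Proof. by rewrite inner_gramC innerC. Qed.

Lemma sqnorm_gram_ge0 v : 0 <= sqnorm G v.
Proof.
rewrite /sqnorm inner_gram mulr_ge0 ?invr_ge0 ?ler0n// sumr_ge0// => i _.
by rewrite -expr2 sqr_ge0.
Qed.

Lemma sqnorm_gramD u v :
  sqnorm G (u + v) = sqnorm G u + 2 * inner u (G *m v) + sqnorm G v.
Proof.
rewrite /sqnorm mulmxDr innerDr !(innerC (u + v)) !innerDr.
rewrite !(innerC (G *m _)) (inner_gramC v u); ring.
Qed.

Lemma sqnorm_gramZ a v : sqnorm G (a *: v) = a ^+ 2 * sqnorm G v.
Proof. by rewrite /sqnorm -scalemxAr innerZr innerC innerZr mulrA innerC. Qed.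

Lemma sqnorm_gramN v : sqnorm G (- v) = sqnorm G v.
Proof. by rewrite -scaleN1r sqnorm_gramZ sqrrN expr1n mul1r. Qed.

Lemma sqnorm_gramZB_ge0 a u v :
  0 <= a ^+ 2 * sqnorm G u - 2 * a * inner u (G *m v) + sqnorm G v.
Proof.
have := sqnorm_gram_ge0 (a *: u + (- 1) *: v).
rewrite (sqnorm_gramD (a *: u)) !sqnorm_gramZ -scalemxAr innerZr.
by rewrite (innerC (a *: u)) innerZr (innerC (G *m v)) => h; lra.
Qed.

(** Divide [0 <= sqnorm G (a *: u - v)] by [a]. *)
Lemma sqnorm_gram_young a u v : 0 < a ->
  sqnorm G (u + v) <= (1 + a) * sqnorm G u + (1 + a^-1) * sqnorm G v.
Proof.
move=> a0; have h := sqnorm_gramZB_ge0 a u v.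
rewrite sqnorm_gramD -subr_ge0.
set B := inner u _ in h *; set U := sqnorm G u in h *; set V := sqnorm G v in h *.
have -> : (1 + a) * U + (1 + a^-1) * V - (U + 2 * B + V)
  = a^-1 * (a ^+ 2 * U - 2 * a * B + V).
  by field; rewrite gt_eqF.
by rewrite mulr_ge0 // invr_ge0 ltW.
Qed.

Context {lam rho : R}.
Hypothesis N_gt0 : (0 < N)%N.
Hypothesis lam_gt0 : 0 < lam.
Hypothesis rho_gt0 : 0 < rho.
Hypothesis gram_ge : forall v, lam * sqnorm G v <= inner (G *m v) (G *m v).
Hypothesis gram_le : forall i, sqnorm G (q i) <= rho.

Let avgC (c : R) : N%:R^-1 * \sum_(i < N) c = c.
Proof.
by rewrite sumr_const card_ord -[c *+ N]mulr_natl mulrA mulVf ?mul1r// pnatr_eq0 -lt0n.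
Qed.

(** [|G v|^2] is the average of [<q_i, v> <q_i, G v>]; each term is bounded by expanding
    [|a <q_i, v> q_i - v|_G^2 >= 0] and using [|q_i|_G^2 <= rho]. *)
Lemma inner_gram_gram_le a v : 0 < a ->
  2 * inner (G *m v) (G *m v) <= (a * rho + a^-1) * sqnorm G v.
Proof.
move=> a0; rewrite -inner_gram_gram inner_gram mulrCA mulr_sumr.
have -> : (a * rho + a^-1) * sqnorm G v =
    N%:R^-1 * \sum_(i < N) (a * rho * inner (q i) v ^+ 2 + a^-1 * sqnorm G v).
  rewrite big_split mulrDr avgC mulrDl; congr (_ + _).
  by rewrite -mulr_sumr mulrCA /sqnorm inner_gram.
rewrite ler_wpM2l ?invr_ge0 ?ler0n// ler_sum// => i _.
set b := inner (q i) v.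
have h := sqnorm_gramZB_ge0 (a * b) (q i) v.
have hq : a * b ^+ 2 * (rho - sqnorm G (q i)) >= 0.
  by apply: mulr_ge0; [apply: mulr_ge0; [exact: ltW|exact: sqr_ge0]|rewrite subr_ge0].
set c := inner (q i) (G *m v) in h *; set s := sqnorm G (q i) in h hq *.
have : 0 <= a^-1 * ((a * b) ^+ 2 * s - 2 * (a * b) * c + sqnorm G v).
  by rewrite mulr_ge0 // invr_ge0 ltW.
have -> : a^-1 * ((a * b) ^+ 2 * s - 2 * (a * b) * c + sqnorm G v)
  = a * b ^+ 2 * s - 2 * (b * c) + a^-1 * sqnorm G v.
  by field; rewrite gt_eqF.
lra.
Qed.

(** On a [v] of positive seminorm, the lower bound [gram_ge] and the upper bound at [a = lam / rho]
    give [2 * lam <= lam + rho / lam]. *)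
Lemma gram_eq0_or_le : (forall v, sqnorm G v = 0) \/ lam ^+ 2 <= rho.
Proof.
have [[v v_gt0]|h] := pselect (exists v, 0 < sqnorm G v); [right|left=> v].
  have := @inner_gram_gram_le (lam / rho) v (divr_gt0 lam_gt0 rho_gt0).
  have := gram_ge v; set C := inner _ _ => h1 h2.
  have : 2 * lam * sqnorm G v <= (lam / rho * rho + (lam / rho)^-1) * sqnorm G v.
    by apply: le_trans h2; rewrite -mulrA ler_wpM2l.
  rewrite ler_pM2r// divfK ?gt_eqF// invf_div => h3.
  have : lam <= rho / lam by lra.
  by rewrite ler_pdivlMr// expr2.
by apply/eqP; rewrite eq_le sqnorm_gram_ge0 andbT leNgt; apply/negP => v0; apply: h; exists v.
Qed.

Lemma sgd_step (eta mu : R) u z : lam ^+ 2 <= rho ->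
  eta = lam / (6 * rho) -> mu = lam ^+ 2 / (12 * rho) ->
  N%:R^-1 * \sum_j sqnorm G (u - (eta * inner (q j) z) *: q j)
    <= (1 - 2 * mu) * sqnorm G u + 6^-1 * sqnorm G (z - u).
Proof.
move=> lam2 etaE muE.
have eta_gt0 : 0 < eta by rewrite etaE divr_gt0// mulr_gt0.
have Cz := gram_ge z; have Cu := gram_ge u.
have Ce : eta * inner (G *m (z - u)) (G *m (z - u)) <= 6^-1 * sqnorm G (z - u).
  have := @inner_gram_gram_le (lam / rho) (z - u) (divr_gt0 lam_gt0 rho_gt0).
  rewrite divfK ?gt_eqF// invf_div => /(ler_wpM2l (ltW eta_gt0)) h.
  (* The product is [lam ^+ 2 / (6 * rho) + 1 / 6], and [lam ^+ 2 <= rho] makes it at most [1 / 3];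
     half of this is the error coefficient [6^-1]. *)
  have : eta * (lam + rho / lam) <= 3^-1.
    have -> : eta * (lam + rho / lam) = lam ^+ 2 / rho / 6 + 6^-1.
      by rewrite etaE; field; rewrite !gt_eqF.
    have : lam ^+ 2 / rho <= 1 by rewrite ler_pdivrMr// mul1r.
    lra.
  move=> /(ler_wpM2r (sqnorm_gram_ge0 (z - u))); lra.
have Csplit : inner (G *m (z - u)) (G *m (z - u)) =
    inner (G *m z) (G *m z) + inner (G *m u) (G *m u) - 2 * inner (G *m z) (G *m u).
  rewrite mulmxBr innerBr !(innerC (_ - _)) !innerBr (innerC (G *m u) (G *m z)); ring.
have -> : \sum_j sqnorm G (u - (eta * inner (q j) z) *: q j) =
    \sum_(j < N) sqnorm G u
    - 2 * eta * \sum_j inner (q j) z * inner (q j) (G *m u)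
    + eta ^+ 2 * \sum_j inner (q j) z ^+ 2 * sqnorm G (q j).
  rewrite !mulr_sumr -sumrB -big_split; apply: eq_bigr => j _ /=.
  rewrite -scaleNr sqnorm_gramD sqnorm_gramZ -scalemxAr innerZr inner_gramC; ring.
have Sz : N%:R^-1 * (\sum_j inner (q j) z ^+ 2 * sqnorm G (q j)) <= rho * sqnorm G z.
  rewrite {2}/sqnorm inner_gram mulrCA ler_wpM2l ?invr_ge0 ?ler0n//.
  rewrite mulr_sumr ler_sum// => j _.
  by rewrite -expr2 mulrC ler_wpM2r ?sqr_ge0.
have := inner_gram z (G *m u); rewrite inner_gram_gram => Czu.
rewrite mulrDr mulrBr avgC mulrCA -Czu [X in _ + X]mulrCA.
have := ler_wpM2l (sqr_ge0 eta) Sz.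
(* As [eta * rho = lam / 6], the second-order term costs a sixth of the decrease
   [eta * lam * sqnorm G z] supplied by the cross term. *)
have -> : eta ^+ 2 * (rho * sqnorm G z) = eta * lam / 6 * sqnorm G z.
  by rewrite etaE; field; rewrite gt_eqF.
have : 0 <= eta * lam * sqnorm G z.
  by rewrite mulr_ge0 ?sqnorm_gram_ge0// mulr_ge0// ltW.
have := ler_wpM2l (ltW eta_gt0) Cz; have := ler_wpM2l (ltW eta_gt0) Cu.
(* The other decrease, [eta * lam * sqnorm G u], is the contraction by [2 * mu]. *)
have -> : 2 * mu = eta * lam by rewrite muE etaE; field; rewrite gt_eqF.
rewrite Csplit in Ce; lra.
Qed.

End Gram.
Section HistoryMean.
Context {R : realType} {N : nat}.
Implicit Types (f g : seq 'I_N -> R) (h : seq 'I_N).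

(* Average of [g] over the [N ^ t] histories of length [t]; histories list the
   most recent index first. *)
Fixpoint history_mean t g : R :=
  if t is s.+1 then history_mean s (fun h => N%:R^-1 * \sum_i g (i :: h))
  else g [::].

Lemma eq_history_mean t f g : f =1 g -> history_mean t f = history_mean t g.
Proof. by move=> /funext ->. Qed.

Lemma le_history_mean t f g :
  (forall h, f h <= g h) -> history_mean t f <= history_mean t g.
Proof.
elim: t f g => [|t IH] f g fg //=; apply: IH => h.
by rewrite ler_wpM2l ?invr_ge0 ?ler0n// ler_sum.
Qed.

Lemma history_meanD t f g :
  history_mean t (fun h => f h + g h) = history_mean t f + history_mean t g.
Proof.
elim: t f g => [|t IH] f g //=; rewrite -IH; apply: eq_history_mean => h.
by rewrite big_split mulrDr.
Qed.

Lemma history_meanZ t a g :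
  history_mean t (fun h => a * g h) = a * history_mean t g.
Proof.
elim: t g => [|t IH] g //=; rewrite -IH; apply: eq_history_mean => h.
by rewrite -mulr_sumr mulrCA.
Qed.

Lemma history_mean0 t : history_mean t (fun=> 0) = 0.
Proof. by elim: t => [|t IH] //=; rewrite big1_eq mulr0. Qed.

Lemma history_mean_sum (I : Type) (r : seq I) t (F : I -> seq 'I_N -> R) :
  history_mean t (fun h => \sum_(i <- r) F i h)
  = \sum_(i <- r) history_mean t (F i).
Proof.
elim: r => [|i r IH].
  by rewrite big_nil -[RHS](history_mean0 t); apply: eq_history_mean => h; rewrite big_nil.
by rewrite big_cons -IH -history_meanD; apply: eq_history_mean => h; rewrite big_cons.
Qed.

End HistoryMean.

(** * Expectations over the draws as averages over histories *)

Definition history (Omega : Type) (N : nat) (xi : nat -> Omega -> 'I_N) t omega :=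
  [seq xi s omega | s <- rev (iota 0 t)].

(** The reversal puts the newest draw at the head, as [history_mean] and a [foldr] expect. *)
Lemma historyS (Omega : Type) (N : nat) (xi : nat -> Omega -> 'I_N) t omega :
  history xi t.+1 omega = xi t omega :: history xi t omega.
Proof. by rewrite /history -addn1 iotaD rev_cat. Qed.

Section Sampling.
Context {dO : measure_display} {Omega : measurableType dO} {R : realType}.
Context {N : nat}.
Variables (P : probability Omega R) (xi : nat -> Omega -> 'I_N).
Hypothesis xi_iid : iid_uniform P xi.

Let cyl (J : seq nat) (b : nat -> 'I_N) : set Omega :=
  \bigcap_(s in [set` J]) xi s @^-1` [set b s].

Let measurable_cyl J b : measurable (cyl J b).
Proof. by case: xi_iid => mxi _ _; apply: fin_bigcap_measurable. Qed.

Let cylE J b : uniq J -> P (cyl J b) = (N%:R^-1 ^+ size J)%:E.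
Proof.
case: xi_iid => _ uni indep uJ.
rewrite /cyl indep//; under eq_bigr do rewrite uni.
by rewrite prodEFin big_const_seq count_predT iter_mulr_1.
Qed.

(* Restricting to a cylinder over the draws [J], all at times [>= t], is what
   makes the induction on [t] go through. *)
Let integral_history_cyl t g J b : uniq J -> all (leq t) J ->
  P.-integrable setT (fun omega => (g (history xi t omega) * \1_(cyl J b) omega)%:E)
  /\ (\int[P]_omega (g (history xi t omega) * \1_(cyl J b) omega)%:E)%E
     = (history_mean t g * N%:R^-1 ^+ size J)%:E.
Proof.
elim: t g J b => [|t IH] g J b uJ leJ.
  have intI := integrable_indic P (measurable_cyl J b).
  split; first by under eq_fun do rewrite /history /= EFinM; exact: integrableZl.
  under eq_integral do rewrite /history /= EFinM.
  rewrite integralZl// integral_indic// setIT EFinM.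
  by congr (_ * _)%E; exact: cylE.
have tJ : t \notin J by apply/negP => /(allP leJ); rewrite ltnn.
have uJ' : uniq (t :: J) by rewrite /= tJ.
have leJ' : all (leq t) (t :: J).
  by rewrite /= leqnn; apply: sub_all leJ => s /ltnW.
(* Fixing draw [t] to each [i] in turn partitions the cylinder: at [omega] only the summand
   [i = xi t omega] survives. The extra factor [N%:R^-1] is the weight in [history_mean]. *)
pose b' i s := if s == t then i else b s.
have split_draw omega : (g (history xi t.+1 omega) * \1_(cyl J b) omega)%:E =
    (\sum_(i < N) (g (i :: history xi t omega) * \1_(cyl (t :: J) (b' i)) omega)%:E)%E.
  rewrite sumEFin historyS (bigD1 (xi t omega))//= big1 ?addr0 => [|i neq].
    congr ((_ * _)%:E); rewrite !indicE; congr (_%:R); congr (nat_of_bool _).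
    apply/idP/idP; rewrite !inE => H s /=; last first.
      move=> sJ; have := H s; rewrite /= inE sJ orbT /b' => /(_ isT).
      by case: eqP => // st; rewrite -st sJ in tJ.
    rewrite inE /b'; case: eqP => [->//|_ /= sJ]; exact: H.
  rewrite indicE memNset ?mulr0// => /(_ t); rewrite /= inE eqxx => /(_ isT).
  by rewrite /b' eqxx => xiE; rewrite xiE eqxx in neq.
have int i := IH (fun h => g (i :: h)) (t :: J) (b' i) uJ' leJ'.
split.
  by under eq_fun do rewrite split_draw; apply: integrable_sum => // i _; exact: (int i).1.
under eq_integral do rewrite split_draw.
rewrite integral_sum//; last by move=> i; exact: (int i).1.
under eq_bigr do rewrite (int _).2.
rewrite sumEFin; congr (_%:E) => /=.
rewrite history_meanZ history_mean_sum -mulr_suml exprS; ring.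
Qed.

Lemma expectation_history t g : (0 < N)%N ->
  'E_P[fun omega => g (history xi t omega)]%E = (history_mean t g)%:E.
Proof.
move=> N_gt0; rewrite unlock.
(* With no draw fixed, the cylinder is the whole space. *)
have [_] := @integral_history_cyl t g [::] (fun=> Ordinal N_gt0) isT isT.
rewrite expr0 mulr1 => <-; apply: eq_integral => omega _.
by rewrite /cyl set_nil bigcap_set0 indicT mulr1.
Qed.

End Sampling.
(** Each index is drawn with probability [1 / N > 0], so the event of drawing a counterexample
    cannot be negligible. *)
Lemma iid_uniform_ae (dO : measure_display) (Omega : measurableType dO)
    (R : realType) (P : probability Omega R) (N : nat)
    (xi : nat -> Omega -> 'I_N) (pr : 'I_N -> Prop) (t : nat) :
  iid_uniform P xi -> {ae P, forall omega, pr (xi t omega)} -> forall i, pr i.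
Proof.
move=> [mxi uni _] aepr i; apply: contrapT => npr.
have : P (xi t @^-1` [set i]) = 0%E.
  apply: measure_negligible; first exact: mxi.
  by apply: negligibleS aepr => omega /= -> /npr.
move=> /eqP; rewrite uni eqe invr_eq0 pnatr_eq0 => /eqP N0.
by case: i {npr} => m; rewrite N0.
Qed.

(** * Unrolling the scalar recursion *)

Lemma descent_recursion (R : realFieldType) (mu : R) (U L E : nat -> R) :
  0 < mu <= 12^-1 -> 0 <= U 0%N -> 0 <= L 0%N -> (forall t, 0 <= E t) ->
  (forall t, U t.+1 <= (1 - 2 * mu) * U t + 6^-1 * E t) ->
  (forall t, 2 * L t <= (1 + mu / 2) * U t + (1 + (mu / 2)^-1) * E t) ->
  U 0%N <= (1 + mu / 2) * (2 * L 0%N) + (1 + (mu / 2)^-1) * E 0%N ->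
  forall t, L t.+1 <= (1 - mu) ^+ t.+1 * L 0%N
    + (6 + 2 * mu^-1) * \sum_(0 <= s < t.+2) (1 - mu) ^ (t%:Z - s%:Z) * E s.
Proof.
(* [U], [L] and [E] stand for the mean squared distance to the interpolant, the mean loss and the
   mean quantization error. *)
move=> /andP[mu0 mu12] U0 L0 E0 U_rec LU UL t.
set r := 1 - mu; pose D t := \sum_(0 <= s < t.+1) r ^ (t%:Z - s%:Z) * E s.
have r0 : 0 < r by rewrite /r; lra.
have r1 : r <= 1 by rewrite /r; lra.
have rt0 k : 0 <= r ^+ k by rewrite exprn_ge0// ltW.
have rz0 (k : int) : 0 <= r ^ k by rewrite exprz_ge0// ltW.
have D0 k : 0 <= D k by rewrite sumr_ge0// => s _; rewrite mulr_ge0.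
have DS k : D k.+1 = r * D k + E k.+1.
  rewrite /D big_nat_recr//= subrr expr0z mul1r mulr_sumr; congr (_ + _).
  apply: eq_bigr => s _; rewrite mulrA; congr (_ * _).
  by rewrite intS -addrA expfzDr ?gt_eqF// expr1z.
have DE k : r ^+ k * E 0%N <= D k.
  rewrite /D big_nat_recl//= subr0 -exprnP lerDl sumr_ge0// => s _.
  by rewrite mulr_ge0.
(* The initial term contracts by [r ^+ 2] per step, since [1 - 2 * mu <= r ^+ 2]; the errors use the
   weaker rate [r]. *)
have U_bound k : U k.+1 <= (r ^+ k.+1) ^+ 2 * U 0%N + 6^-1 * D k.
  elim: k => [|k IH].
    apply: le_trans (U_rec _) _.
    rewrite /D big_nat1 subrr expr0z mul1r expr1 lerD2r ler_wpM2r//.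
    by have := sqr_ge0 mu; rewrite /r; lra.
  apply: le_trans (U_rec _) _; rewrite DS.
  have a0 : 0 <= 1 - 2 * mu by lra.
  have ar : 1 - 2 * mu <= r by rewrite /r; lra.
  have ar2 : 1 - 2 * mu <= r ^+ 2 by have := sqr_ge0 mu; rewrite /r; lra.
  have := ler_wpM2l a0 IH; have := ler_wpM2r (D0 k) ar.
  have := ler_wpM2r (mulr_ge0 (sqr_ge0 (r ^+ k.+1)) U0) ar2.
  have -> : (r ^+ k.+2) ^+ 2 = r ^+ 2 * (r ^+ k.+1) ^+ 2.
    by rewrite -exprMn -exprS.
  lra.
(* The sum goes one index beyond [D t]: the term [s = t.+1] has weight [r^-1 >= 1]. *)
rewrite big_nat_recr//= -/(D t).
have -> : r ^ (t%:Z - t.+1%:Z) = r^-1.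
  by rewrite intS opprD addrCA subrr addr0 exprN1.
set rho := r ^+ t.+1; set c := 1 + (mu / 2)^-1.
have cE : c = 1 + 2 * mu^-1 by rewrite /c; field; rewrite gt_eqF.
have muV0 : 0 < mu^-1 by rewrite invr_gt0.
(* [(1 + mu / 2) ^+ 2 * (1 - mu) <= 1] lets one spare factor [r] absorb both
   passages between the iterate and its quantization. *)
have b2 : (1 + mu / 2) ^+ 2 * r <= 1 by rewrite /r; nra.
have b1 : (1 + mu / 2) * r <= 1 by rewrite /r; nra.
have b0 : 0 <= 1 + mu / 2 by lra.
have rho_r : rho <= r.
  rewrite /rho exprS; apply: ler_piMr; first exact: ltW.
  by apply: exprn_ile1 => //; exact: ltW.
have rho1 : rho <= 1 by exact: le_trans rho_r r1.
have h1 : (1 + mu / 2) ^+ 2 * rho ^+ 2 * L 0%N <= rho * L 0%N.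
  rewrite ler_wpM2r// expr2 mulrA ler_piMl ?rt0//.
  by apply: le_trans b2; rewrite ler_wpM2l ?sqr_ge0.
(* The [E 0] from passing to the initial loss is absorbed by the first term of [D t]. *)
have h2 : (1 + mu / 2) * rho ^+ 2 * E 0%N <= D t.
  apply: le_trans (DE t); rewrite ler_wpM2r// expr2 mulrA.
  apply: (@le_trans _ _ rho); first rewrite ler_piMl ?rt0//.
    by apply: le_trans b1; rewrite ler_wpM2l.
  by rewrite /rho exprS ler_piMl ?rt0.
have h3 : E t.+1 <= r^-1 * E t.+1.
  by rewrite ler_peMl// invf_ge1.
have c0 : 0 <= c by rewrite cE; lra.
(* After halving, [D t] has coefficient [(c + (1 + mu / 2) / 6) / 2] and the last term [c / 2], both
   below [6 + 2 * mu^-1]. *)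
have k1 := LU t.+1; have k2 := ler_wpM2l b0 (U_bound t).
have k3 := ler_wpM2l (mulr_ge0 b0 (sqr_ge0 rho)) UL.
have k4 := ler_wpM2l c0 h2; have k5 := ler_wpM2l c0 h3.
have k6 : mu * D t <= 12^-1 * D t by rewrite ler_wpM2r.
have k7 := mulr_ge0 (ltW muV0) (D0 t).
have k8 : 0 <= r^-1 * E t.+1 by apply: le_trans (E0 _) h3.
have k9 := mulr_ge0 (ltW muV0) k8.
have k10 := D0 t.
rewrite -/c -/rho in k1 k2 k3.
move: (U t.+1) (L t.+1) (r^-1 * E t.+1) k1 k2 k5 k8 k9 => Ut Lt Et k1 k2 k5 k8 k9.
rewrite cE in k1 k3 k4 k5.
lra.
Qed.

(** * The quantized iterates and the final bound *)

Lemma qsgd_history (R : realType) (d N : nat)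
    (x : 'I_N -> 'cV[R]_d.+1) (y : 'I_N -> R) (A : 'M[R]_d.+1)
    (Qx Qw : quantizer R) (eta : R) (w0 : 'cV[R]_d.+1) (Omega : Type)
    (xi : nat -> Omega -> 'I_N) (omega : Omega) (t : nat) :
  qsgd x y A Qx Qw eta w0 (fun s => xi s omega) t =
  foldr (fun i w => w - (eta * (inner (quantize Qx (A *m x i))
                                 (quantize Qw (A *m w)) - y i))
                        *: (A^T *m quantize Qx (A *m x i)))
    w0 (history xi t omega).
Proof. by elim: t => [//|t IH]; rewrite historyS /= -IH. Qed.

Theorem theorem4p3 (R : realType) (d N T : nat)
  (N_gt0 : (0 < N)%N) (T_gt0 : (0 < T)%N)
  (x : 'I_N -> 'cV[R]_d.+1) (y : 'I_N -> R)
  (A : 'M[R]_d.+1) (A_orth : orthogonal_mx A)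
  (Qx Qw : quantizer R)
  (dO : measure_display) (Omega : measurableType dO)
  (P : probability Omega R) (xi : nat -> Omega -> 'I_N)
  (xi_iid : iid_uniform P xi)
  (w0 : 'cV[R]_d.+1) (lambda_min rho eta : R)
  (lambda_min_gt0 : 0 < lambda_min) (rho_gt0 : 0 < rho)
  (gram_ge : loewner_ge (qgram x A Qx ^+ 2) (lambda_min *: qgram x A Qx))
  (gram_bound : {ae P, forall omega,
     sup [set sqnorm (qgram x A Qx) (quantize Qx (A *m x (xi t omega)))
         | t in [set t | (t < T)%N]] <= rho})
  (interpolation : forall A' : 'M[R]_d.+1, orthogonal_mx A' ->
     exists wstar : 'cV[R]_d.+1,
       forall i, y i = inner (quantize Qx (A' *m x i)) wstar)
  (eta_def : eta = lambda_min / (6 * rho)) :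
  let mu : R := lambda_min ^+ 2 / (12 * rho) in
  let w (t : nat) (omega : Omega) : 'cV[R]_d.+1 :=
    qsgd x y A Qx Qw eta w0 (fun s => xi s omega) t in
  forall t : nat,
    ('E_P[fun omega => qloss x y A Qx Qw (w t.+1 omega)]
     <= ((1 - mu) ^+ t.+1 * qloss x y A Qx Qw w0)%:E
        + (6 + 2 * mu^-1)%:E *
          \sum_(0 <= s < t.+2)
            ((1 - mu) ^ (t%:Z - s%:Z))%:E *
            'E_P[fun omega =>
                   sqnorm (qgram x A Qx) (qerr Qw (A *m w s omega))])%E.
Proof.
move=> mu w t.
set G := qgram x A Qx in gram_ge gram_bound *.
pose q i := quantize Qx (A *m x i).
have gram_ge' v : lambda_min * sqnorm G v <= inner (G *m v) (G *m v).
  case: gram_ge => _ _ /(_ v).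
  rewrite mulmxBl innerBr -scalemxAl innerZr subr_ge0 => /le_trans; apply.
  by rewrite expr2 -mulmxA (inner_gram_gram q).
have gram_le i : sqnorm G (q i) <= rho.
  (* The first draw is in the range of the supremum, as [0 < T], and reaches every index with
     positive probability. *)
  apply: (iid_uniform_ae (pr := fun i => sqnorm G (q i) <= rho) (t := 0%N) xi_iid).
  apply: filterS gram_bound => omega; apply: le_trans.
  apply: ub_le_sup; last by exists 0%N.
  (* [sup] dominates the elements once the set is bounded above; the sum over the dataset is such a
     bound. *)
  exists (\sum_i sqnorm G (q i)) => _ [s _ <-].
  rewrite (bigD1 (xi s omega))//= lerDl sumr_ge0// => j _.
  exact: (sqnorm_gram_ge0 q).
have [wstar yE] := interpolation A A_orth.
pose W := foldr (fun i w => w - (eta * (inner (q i) (quantize Qw (A *m w)) - y i))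
  *: (A^T *m q i)) w0.
pose z h := quantize Qw (A *m W h) - wstar.
pose u h := A *m W h - wstar.
have lossE h : qloss x y A Qx Qw (W h) = 2^-1 * sqnorm G (z h).
  rewrite /qloss /sqnorm (inner_gram q); congr (_ * (_ * _)).
  by apply: eq_bigr => i _; rewrite -/(q i) yE -innerBr expr2.
have loss2E h : 2 * qloss x y A Qx Qw (W h) = sqnorm G (z h).
  by rewrite lossE mulrA divff// mul1r.
have errE h : qerr Qw (A *m W h) = z h - u h.
  by rewrite /z /u opprB addrA subrK.
(* Orthogonality cancels the rotation of the update, and interpolation turns the residual into
   [<q_i, z>]. *)
have uS i h : u (i :: h) = u h - (eta * inner (q i) (z h)) *: q i.
  rewrite /u /= mulmxBr -scalemxAr mulmxA A_orth mul1mx yE -innerBr.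
  by rewrite addrAC.
pose U s := history_mean s (fun h => sqnorm G (u h)).
pose L s := history_mean s (fun h => qloss x y A Qx Qw (W h)).
pose E s := history_mean s (fun h => sqnorm G (qerr Qw (A *m W h))).
have EL s : 'E_P[fun omega => qloss x y A Qx Qw (w s omega)]%E = (L s)%:E.
  rewrite -(expectation_history xi_iid)//; congr ('E_P[_])%E.
  by apply/funext => omega; rewrite /w qsgd_history.
have EE s : 'E_P[fun omega => sqnorm G (qerr Qw (A *m w s omega))]%E = (E s)%:E.
  rewrite -(expectation_history xi_iid)//; congr ('E_P[_])%E.
  by apply/funext => omega; rewrite /w qsgd_history.
rewrite EL; under eq_bigr do rewrite EE -EFinM.
rewrite sumEFin -EFinM -EFinD lee_fin.
have -> : qloss x y A Qx Qw w0 = L 0%N by [].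
(* If the seminorm vanishes, both sides are zero; otherwise [mu <= 12^-1]. *)
have [G0|lam_le] := gram_eq0_or_le N_gt0 lambda_min_gt0 rho_gt0 gram_ge' gram_le.
  have L0 s : L s = 0.
    rewrite -(@history_mean0 R N s); apply: eq_history_mean => h.
    by rewrite lossE [sqnorm _ _]G0 mulr0.
  have E0 s : E s = 0.
    by rewrite -(@history_mean0 R N s); apply: eq_history_mean => h; rewrite [LHS]G0.
  rewrite !L0 big1 => [|s _]; last by rewrite E0 mulr0.
  by rewrite !mulr0 addr0.
have mu_gt0 : 0 < mu by rewrite divr_gt0 ?exprn_gt0 ?mulr_gt0.
have mu2_gt0 : 0 < mu / 2 by rewrite divr_gt0.
have mu_le : mu <= 12^-1.
  by rewrite /mu ler_pdivrMr ?mulr_gt0// mulrA mulVf// mul1r.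
have mean_ge0 s (f : seq 'I_N -> R) : (forall h, 0 <= f h) -> 0 <= history_mean s f.
  by move=> f0; rewrite -(@history_mean0 R N s); exact: le_history_mean.
apply: (@descent_recursion _ mu U L E) => [| | |s|s|s|].
- by rewrite mu_gt0.
- exact: (sqnorm_gram_ge0 q).
- by rewrite [L _](lossE [::]) mulr_ge0 ?invr_ge0// (sqnorm_gram_ge0 q).
- by apply: mean_ge0 => h; exact: (sqnorm_gram_ge0 q).
(* The innermost average is over the newest draw, with the older history [h] fixed. *)
- rewrite /U /E -!history_meanZ -history_meanD /=; apply: le_history_mean => h.
  under eq_bigr do rewrite uS.
  by rewrite errE; exact: (sgd_step N_gt0 lambda_min_gt0 rho_gt0 gram_ge' gram_le).
- rewrite /U /E /L -!history_meanZ -history_meanD; apply: le_history_mean => h.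
  rewrite loss2E errE -{1}(subrKC (u h) (z h)).
  exact: (sqnorm_gram_young q).
(* At time 0 the splitting is reversed: [u = z + (u - z)]. *)
- have L0E : 2 * L 0%N = sqnorm G (z [::]) by exact: loss2E.
  have E0E : E 0%N = sqnorm G (u [::] - z [::]).
    rewrite -opprB -(errE [::]); symmetry; exact: (sqnorm_gramN q).
  rewrite L0E E0E.
  have := sqnorm_gram_young q (z [::]) (u [::] - z [::]) mu2_gt0.
  by rewrite subrKC.
Qed.
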